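(* Let $\mathcal{M}$ be a concurrent game model, $q_{in}$ a state of $\mathcal{M}$ and $\varphi$ an ATL-formula. Then $\mathcal{M},q_{in}\models_f\varphi$ if and only if $\mathcal{M},q_{in}\models^g_f\varphi$.
   Context: A concurrent game model (CGM) is $\mathcal{M}=(\mathrm{Agt},\mathrm{St},\Pi,\mathrm{Act},d,o,v)$: $\mathrm{Agt}=\{1,\dots,k\}$ agents; nonempty sets $\mathrm{St}$ (states), $\Pi$ (proposition symbols), $\mathrm{Act}$ (actions); $d:\mathrm{Agt}\times\mathrm{St}\to\mathcal{P}(\mathrm{Act})\setminus\{\emptyset\}$; $o$ assigns to each state $q$ and each action profile $\vec\alpha=(\alpha_1,\dots,\alpha_k)$ with $\alpha_i\in d(i,q)$ an outcome state $o(q,\vec\alpha)$; $v:\Pi\to\mathcal{P}(\mathrm{St})$. For $A\subseteq\mathrm{Agt}$, $\overline{A}=\mathrm{Agt}\setminus A$ and $\mathrm{action}(A,q)$ is the set of tuples $(\alpha_i)_{i\in A}$ with $\alpha_i\in d(i,q)$. A (positional) strategy for agent $a$ is $s_a:\mathrm{St}\to\mathrm{Act}$ with $s_a(q)\in d(a,q)$; a collective strategy $S_A$ is a tuple of strategies, one for each $a\in A$; $\mathrm{paths}(q,S_A)$ is the set of infinite sequences $\Lambda$ of states with $\Lambda[0]=q$ and $\Lambda[n+1]=o(\Lambda[n],\vec\alpha)$ for some action profile $\vec\alpha$ at $\Lambda[n]$ in which every $a\in A$ plays $s_a(\Lambda[n])$. ATL formulae: $\varphi::=p\mid\neg\varphi\mid(\varphi\vee\varphi)\mid\langle\!\langle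 A\rangle\!\rangle\mathsf{X}\varphi\mid\langle\!\langle A\rangle\!\rangle\varphi\,\mathsf{U}\,\varphi\mid\langle\!\langle A\rangle\!\rangle\varphi\,\mathsf{R}\,\varphi$. Finitely bounded compositional semantics $\models_f$: $q\models_f p$ iff $q\in v(p)$; $\neg,\vee$ as usual; $q\models_f\langle\!\langle A\rangle\!\rangle\mathsf{X}\psi$ iff some $S_A$ has $\Lambda[1]\models_f\psi$ for all $\Lambda\in\mathrm{paths}(q,S_A)$; $q\models_f\langle\!\langle A\rangle\!\rangle\psi\mathsf{U}\theta$ iff there exist $n<\omega$ and $S_A$ such that for every $\Lambda\in\mathrm{paths}(q,S_A)$ there is $i\leq n$ with $\Lambda[i]\models_f\theta$ and $\Lambda[j]\models_f\psi$ for all $j<i$; $q\models_f\langle\!\langle A\rangle\!\rangle\psi\mathsf{R}\theta$ iff for every $n<\omega$ there is $S_{A,n}$ such that for every $\Lambda\in\mathrm{paths}(q,S_{A,n})$ and $i\leq n$, $\Lambda[i]\models_f\theta$ or $\Lambda[j]\models_f\psi$ for some $j<i$. Players: Eloise $\mathbf{E}$, Abelard $\mathbf{A}$; $\overline{\mathbf{P}}$ is the opponent of $\mathbf{P}$. One step game $\mathrm{step}(\mathbf{P},A,q)$: $\mathbf{P}$ picks a tuple in $\mathrm{action}(A,q)$, then $\overline{\mathbf{P}}$ picks a tuple in $\mathrm{action}(\overline{A},q)$; the resulting state is the outcome. Finitely bounded evaluation game $\mathcal{G}(\mathcal{M},q_{in},\varphi,\omega)$: positions $(\mathbf{P},q,\psi)$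 with $\psi$ a subformula of $\varphi$; start $(\mathbf{E},q_{in},\varphi)$. At $(\mathbf{P},q,p)$ the game ends, $\mathbf{P}$ wins iff $q\in v(p)$, else $\overline{\mathbf{P}}$ wins. $(\mathbf{P},q,\neg\psi)\to(\overline{\mathbf{P}},q,\psi)$. At $(\mathbf{P},q,\psi\vee\theta)$, $\mathbf{P}$ chooses $(\mathbf{P},q,\psi)$ or $(\mathbf{P},q,\theta)$. At $(\mathbf{P},q,\langle\!\langle A\rangle\!\rangle\mathsf{X}\psi)$, $\mathrm{step}(\mathbf{P},A,q)$ gives $q'$, next $(\mathbf{P},q',\psi)$. At $(\mathbf{P},q,\langle\!\langle A\rangle\!\rangle\psi\mathsf{U}\theta)$ the embedded game $\mathbf{g}(\mathbf{P},\mathbf{P},A,q,\theta,\psi)$ is played; at $(\mathbf{P},q,\langle\!\langle A\rangle\!\rangle\psi\mathsf{R}\theta)$ the embedded game $\mathbf{g}(\mathbf{P},\overline{\mathbf{P}},A,q,\theta,\psi)$. In an embedded game $\mathbf{g}(\mathbf{V},\mathbf{C},A,q_0,\psi_{\mathbf{C}},\psi_{\overline{\mathbf{C}}})$ (verifier $\mathbf{V}$, controller $\mathbf{C}$), $\mathbf{C}$ first chooses a natural number $n$; play goes through configurations $(m,q)$ from $(n,q_0)$ with rules in order: (i) if $m=0$ end at exit position $(\mathbf{V},q,\psi_{\mathbf{C}})$; (ii) $\mathbf{C}$ may end at $(\mathbf{V},q,\psi_{\mathbf{C}})$; (iii) $\overline{\mathbf{C}}$ may end at $(\mathbf{V},q,\psi_{\overline{\mathbf{C}}})$;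 (iv) otherwise $\mathrm{step}(\mathbf{V},A,q)$ gives $q'$, continue from $(m-1,q')$. The evaluation game continues from the exit position. Strategies specify disjunct choices, action tuples (as verifier) or response functions $\mathrm{action}(A,q)\to\mathrm{action}(\overline{A},q)$ (as falsifier) in one step games, and at until/release positions: for the controller, a time limit $n<\omega$ and an embedded strategy; for the non-controller, for each $n<\omega$ an embedded strategy; embedded strategies are functions of configurations $(m,q)$ giving ''end the game'' (as permitted by the role) or an action tuple / response function. $\mathcal{M},q\models^g_f\varphi$ iff $\mathbf{E}$ has a strategy winning all consistent plays of $\mathcal{G}(\mathcal{M},q,\varphi,\omega)$. *)

(* Defs.v *)
From mathcomp Require Import all_boot.

Set Implicit Arguments.
Unset Strict Implicit.
Unset Printing Implicit Defensive.

(* Agents are numbered 0, ..., k-1; subsets of Act and St are predicates. *)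
Record cgm : Type := CGM {
  nagt : nat;
  St : Type;
  Prp : Type;
  Act : Type;
  St_inhabited : inhabited St;
  Prp_inhabited : inhabited Prp;
  Act_inhabited : inhabited Act;
  avail : 'I_nagt -> St -> Act -> Prop;
  avail_nonempty : forall a q, exists x, avail a q x;
  outcome : forall q : St, (forall a : 'I_nagt, {x : Act | avail a q x}) -> St;
  val_of : Prp -> St -> Prop
}.

Arguments avail : clear implicits.
Arguments outcome : clear implicits.
Arguments val_of : clear implicits.

Definition coalition (M : cgm) : Type := {set 'I_(nagt M)}.

Definition action_at (M : cgm) (a : 'I_(nagt M)) (q : St M) : Type :=
  {x : Act M | avail M a q x}.

Definition profile (M : cgm) (q : St M) : Type :=
  forall a : 'I_(nagt M), action_at a q.

Definition action (M : cgm) (A : coalition M) (q : St M) : Type :=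
  forall a : 'I_(nagt M), a \in A -> action_at a q.

Definition merge (M : cgm) (A : coalition M) (q : St M)
    (alpha : action A q) (beta : action (~: A) q) : profile q :=
  fun a => match @idP (a \in A) with
           | ReflectT aA => alpha a aA
           | ReflectF aNA => beta a (introT setCP aNA)
           end.

Inductive formula (M : cgm) : Type :=
| Var of Prp M
| Neg of formula M
| Or of formula M & formula M
| Next of coalition M & formula M
| Until of coalition M & formula M & formula M     (* <<A>> psi U theta *)
| Release of coalition M & formula M & formula M.  (* <<A>> psi R theta *)

Definition pos_strategy (M : cgm) (a : 'I_(nagt M)) : Type :=
  forall q : St M, action_at a q.

Definition coll_strategy (M : cgm) (A : coalition M) : Type :=
  forall a : 'I_(nagt M), a \in A -> pos_strategy a.

Definition paths (M : cgm) (A : coalition M) (q : St M) (S : coll_strategy A)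
    (L : nat -> St M) : Prop :=
  L 0 = q /\
  forall n, exists alpha : profile (L n),
    (forall a (aA : a \in A), alpha a = S a aA (L n)) /\
    L n.+1 = outcome M (L n) alpha.

Fixpoint sat_f (M : cgm) (q : St M) (phi : formula M) {struct phi} : Prop :=
  match phi with
  | Var p => val_of M p q
  | Neg psi => ~ sat_f q psi
  | Or psi theta => sat_f q psi \/ sat_f q theta
  | Next A psi =>
      exists S : coll_strategy A, forall L, paths q S L -> sat_f (L 1) psi
  | Until A psi theta =>
      exists (n : nat) (S : coll_strategy A), forall L, paths q S L ->
        exists i, [/\ i <= n, sat_f (L i) theta
                    & forall j, j < i -> sat_f (L j) psi]
  | Release A psi theta =>
      forall n : nat, exists S : coll_strategy A, forall L, paths q S L ->
        forall i, i <= n ->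
          sat_f (L i) theta \/ exists2 j, j < i & sat_f (L j) psi
  end.

Inductive player : Type := Eloise | Abelard.

Definition opp (P : player) : player :=
  match P with Eloise => Abelard | Abelard => Eloise end.

Definition same (P Q : player) : bool :=
  match P, Q with
  | Eloise, Eloise | Abelard, Abelard => true
  | _, _ => false
  end.

(* What a player fixes for the one step game step(V, A, q): an action tuple
   as the verifier (isV = true), a response function as the falsifier. *)
Definition step_choice (M : cgm) (isV : bool) (A : coalition M) (q : St M)
    : Type :=
  if isV then action A q else action A q -> action (~: A) q.

(* The states that step(V, A, q) can produce when one player uses choice c. *)
Definition step_result (M : cgm) (isV : bool) (A : coalition M) (q : St M)
    : step_choice isV A q -> St M -> Prop :=
  match isV return step_choice isV A q -> St M -> Prop with
  | true => fun alpha q' =>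
      exists beta : action (~: A) q, q' = outcome M q (merge alpha beta)
  | false => fun r q' =>
      exists alpha : action A q, q' = outcome M q (merge alpha (r alpha))
  end.

(* The embedded game g(V, C, A, q0, psi_C, psi_{opp C}). *)
Record egame (M : cgm) : Type := EGame {
  eV : player;
  eC : player;
  eA : coalition M;
  eq0 : St M;
  eformC : formula M;
  eformN : formula M
}.

(* Function of the configuration (m, q); [None] is "end the game". Whether this
   means exiting with psi_C or psi_{opp C} depends on the player's role. *)
Definition estrategy (M : cgm) (isV : bool) (A : coalition M) : Type :=
  forall (m : nat) (q : St M), option (step_choice isV A q).

Definition econtrol (M : cgm) (isC isV : bool) (A : coalition M) : Type :=
  if isC then (nat * estrategy isV A)%type else nat -> estrategy isV A.

Definition elimit_ok (M : cgm) (isC isV : bool) (A : coalition M)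
    : econtrol isC isV A -> nat -> Prop :=
  match isC return econtrol isC isV A -> nat -> Prop with
  | true => fun c n => n = c.1
  | false => fun _ _ => True
  end.

Definition estrategy_for (M : cgm) (isC isV : bool) (A : coalition M)
    : econtrol isC isV A -> nat -> estrategy isV A :=
  match isC return econtrol isC isV A -> nat -> estrategy isV A with
  | true => fun c _ => c.2
  | false => fun c n => c n
  end.

(* A strategy of P is a function of the position:
   - [on_or q psi theta] is the choice at (P, q, psi \/ theta), true = psi;
   - [on_next V q A psi] is the choice at (V, q, <<A>>X psi);
   - [on_egame g] is the choice at the until/release position that starts g;
     that position is (V, q0, <<A>> psi_{opp C} U psi_C) if V = C and
     (V, q0, <<A>> psi_{opp C} R psi_C) otherwise.
   Values at positions outside the game at hand are irrelevant. *)
Record strategy (M : cgm) (P : player) : Type := Strategy {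
  on_or : St M -> formula M -> formula M -> bool;
  on_next : forall (V : player) (q : St M) (A : coalition M),
    formula M -> step_choice (same P V) A q;
  on_egame : forall g : egame M,
    econtrol (same P (eC g)) (same P (eV g)) (eA g)
}.

(* [Conf g n m q]: configuration (m, q) of the embedded game g played with
   time limit n. *)
Inductive location (M : cgm) : Type :=
| Pos of player & St M & formula M
| Conf of egame M & nat & nat & St M.

Definition emb_move (M : cgm) (P : player) (Sg : strategy M P) (g : egame M)
    (n m : nat) (q : St M) : option (step_choice (same P (eV g)) (eA g) q) :=
  estrategy_for (on_egame Sg g) n m q.

(* [cmove Sg x y]: the play may go from x to y when P follows Sg and the
   opponent moves freely. *)
Inductive cmove (M : cgm) (P : player) (Sg : strategy M P)
    : location M -> location M -> Prop :=
| cm_neg V q psi :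
    cmove Sg (Pos V q (Neg psi)) (Pos (opp V) q psi)
| cm_or V q psi theta (b : bool) :
    (V = P -> b = on_or Sg q psi theta) ->
    cmove Sg (Pos V q (Or psi theta)) (Pos V q (if b then psi else theta))
| cm_next V q A psi q' :
    step_result (on_next Sg V q A psi) q' ->
    cmove Sg (Pos V q (Next A psi)) (Pos V q' psi)
| cm_until V q A psi theta n (g := EGame V V A q theta psi) :
    elimit_ok (on_egame Sg g) n ->
    cmove Sg (Pos V q (Until A psi theta)) (Conf g n n q)
| cm_release V q A psi theta n (g := EGame V (opp V) A q theta psi) :
    elimit_ok (on_egame Sg g) n ->
    cmove Sg (Pos V q (Release A psi theta)) (Conf g n n q)
| cm_timeout g n q :
    cmove Sg (Conf g n 0 q) (Pos (eV g) q (eformC g))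
  (* The controller ends the game. *)
| cm_endC g n m q :
    (eC g = P -> emb_move Sg g n m.+1 q = None) ->
    cmove Sg (Conf g n m.+1 q) (Pos (eV g) q (eformC g))
  (* The controller does not end the game, but the other player does. *)
| cm_endN g n m q :
    (eC g = P -> emb_move Sg g n m.+1 q <> None) ->
    (eC g <> P -> emb_move Sg g n m.+1 q = None) ->
    cmove Sg (Conf g n m.+1 q) (Pos (eV g) q (eformN g))
  (* Neither player ends the game. *)
| cm_step g n m q c q' :
    emb_move Sg g n m.+1 q = Some c ->
    step_result c q' ->
    cmove Sg (Conf g n m.+1 q) (Conf g n m q').

(* Every play is finite: exits and moves between positions shrink the formula,
   and steps of an embedded game decrease m. So plays are finite sequences
   x :: s, and a play is complete when it reaches a proposition symbol. *)
Fixpoint consistent_play (M : cgm) (P : player) (Sg : strategy M P)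
    (x : location M) (s : seq (location M)) {struct s} : Prop :=
  match s with
  | [::] => True
  | y :: s' => cmove Sg x y /\ consistent_play Sg y s'
  end.

Definition wins_at (M : cgm) (P V : player) (q : St M) (p : Prp M) : Prop :=
  (V = P /\ val_of M p q) \/ (V = opp P /\ ~ val_of M p q).

Definition winning (M : cgm) (P : player) (Sg : strategy M P) (x : location M)
    : Prop :=
  forall s V q p, consistent_play Sg x s -> last x s = Pos V q (Var p) ->
    wins_at P V q p.

Definition gsat_f (M : cgm) (q : St M) (phi : formula M) : Prop :=
  exists Sg : strategy M Eloise, winning Sg (Pos Eloise q phi).

(* Main.v *)
Require Import Defs.
From mathcomp Require Import all_boot.
From Stdlib Require Import ClassicalEpsilon FunctionalExtensionality.

(** Truth extends from positions to configurations of embedded games: read from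
    one player's side, the configurations won with m steps left satisfy a
    recursion on m ([bounded_win]).  Until and release unfold to "some n" and
    "all n" of this recursion.  A winning action depends on m as well as on the
    state; to turn it into a positional strategy, one plays at each state for
    the least (until) or the greatest admissible (release) m that wins there.
    Then a strategy of Eloise assembled by choice never leaves the true
    locations, while against any strategy of hers a play can be kept inside the
    false ones. *)

Set Implicit Arguments.
Unset Strict Implicit.
Unset Printing Implicit Defensive.

(** * One step games and the recursion on remaining steps *)

Section OneStep.

Variable M : cgm.
Implicit Types (A : coalition M) (q : St M) (X : St M -> Prop).

Definition can_force (isV : bool) A q X : Prop :=
  exists c : step_choice isV A q, forall q', step_result c q' -> X q'.

Lemma can_force_mono (isV : bool) A q X Y :
  (forall q', X q' -> Y q') -> can_force isV A q X -> can_force isV A q Y.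
Proof. by move=> XY [c cX]; exists c => q' /cX /XY. Qed.

(** Determinacy of the one step game: if every tuple of the verifier has a good answer, choice
    collects these answers into a single response function. *)
Lemma can_force_falsifier A q X :
  can_force false A q X <-> ~ can_force true A q (fun q' => ~ X q').
Proof.
split=> [[r rX] [alpha alphaN]|nF].
  apply: (alphaN (outcome M q (Defs.merge alpha (r alpha)))); first by exists (r alpha).
  by apply: rX; exists alpha.
have /choice [r rX] : forall alpha : action A q, exists beta : action (~: A) q,
    X (outcome M q (Defs.merge alpha beta)).
  move=> alpha; apply: NNPP => nX; apply: nF; exists alpha => q' [beta ->] Xq'.
  by apply: nX; exists beta.
by exists r => q' [alpha ->].
Qed.

Lemma can_force_dual (isV : bool) A q X :
  can_force (~~ isV) A q X <-> ~ can_force isV A q (fun q' => ~ X q').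
Proof.
case: isV; first exact: can_force_falsifier.
rewrite can_force_falsifier; split=> [F nF|nF].
  by apply: nF; apply: can_force_mono F => q' Xq' nX; apply: nX.
apply: NNPP => nF'; apply: nF => F; apply: nF'.
by apply: can_force_mono F => q'; apply: NNPP.
Qed.

(* Seen by one player: [ctl] and [isV] say whether that player is the
   controller and the verifier; [XC] and [XN] are the exits that are good for
   that player, of the controller and of the non-controller respectively. *)
Fixpoint bounded_win (ctl isV : bool) A (XC XN : St M -> Prop) (m : nat) q
    : Prop :=
  match m with
  | 0 => XC q
  | m'.+1 =>
      let step := can_force isV A q (bounded_win ctl isV A XC XN m') in
      if ctl then XC q \/ XN q /\ step else XC q /\ (XN q \/ step)
  end.

(** Embedded games are determined: the opponent has both roles swapped and complementary exits, so
    [can_force_dual] propagates the negation through each step. *)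
Lemma bounded_win_dual (ctl isV : bool) A (XC XN : St M -> Prop) m q :
  bounded_win (~~ ctl) (~~ isV) A (fun q => ~ XC q) (fun q => ~ XN q) m q <->
  ~ bounded_win ctl isV A XC XN m q.
Proof.
elim: m q => [|m IH] q //=.
have : can_force (~~ isV) A q
    (bounded_win (~~ ctl) (~~ isV) A (fun q => ~ XC q) (fun q => ~ XN q) m) <->
  ~ can_force isV A q (bounded_win ctl isV A XC XN m).
  rewrite can_force_dual; split=> nF F; apply: nF; apply: can_force_mono F => q'.
    by rewrite IH => W nW.
  by rewrite IH; apply: NNPP.
by case: ctl {IH} => /=; tauto.
Qed.

End OneStep.

(** * Positional strategies, their paths and one step forcing *)

Section Paths.

Variables (M : cgm) (A : coalition M).
Implicit Types (q : St M) (S : coll_strategy A) (L : nat -> St M).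

Definition strategy_action S q : step_choice true A q := fun a aA => S a aA q.

Lemma merge_in q (alpha : action A q) beta a (aA : a \in A) :
  Defs.merge alpha beta a = alpha a aA.
Proof.
rewrite /Defs.merge; case: {-}_ / idP => [aA'|] //.
by rewrite (bool_irrelevance aA' aA).
Qed.

Lemma merge_profile q (al : profile q) :
  Defs.merge (fun a (_ : a \in A) => al a) (fun a _ => al a) = al.
Proof.
by apply: functional_extensionality_dep => a; rewrite /Defs.merge; case: {-}_ / idP.
Qed.

Lemma action_exists (B : coalition M) q : inhabited (action B q).
Proof.
constructor=> a _.
exact: constructive_indefinite_description _ (@avail_nonempty M a q).
Qed.

(** Makes a statement about all paths non-vacuous, so that facts about the initial state can be read
    off it. *)
Lemma paths_exists q S : exists L, paths q S L.
Proof.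
have /choice [f fP] : forall q, exists q', step_result (strategy_action S q) q'.
  move=> q0; have [beta] := action_exists (~: A) q0.
  by exists (outcome M q0 (Defs.merge (strategy_action S q0) beta)), beta.
exists (fun n => iter n f q); split=> // n.
have [beta Ebeta] := fP (iter n f q).
exists (Defs.merge (strategy_action S (iter n f q)) beta); split=> // a aA.
exact: merge_in.
Qed.

Lemma paths_cons q q' S L :
  step_result (strategy_action S q) q' -> paths q' S L ->
  paths q S (fun n => if n is n'.+1 then L n' else q).
Proof.
move=> [beta Eq'] [L0 LS]; split=> // -[|n]; last exact: LS.
exists (Defs.merge (strategy_action S q) beta); split; last by rewrite L0.
by move=> a aA; apply: merge_in.
Qed.

Lemma paths_behead q S L :
  paths q S L ->
  step_result (strategy_action S q) (L 1) /\ paths (L 1) S (fun n => L n.+1).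
Proof.
move=> [L0 LS]; split; last by split=> // n; apply: LS.
rewrite -L0; have [al [alS ->]] := LS 0.
exists (fun a _ => al a); rewrite -[in LHS](merge_profile al); congr outcome.
congr Defs.merge.
apply: functional_extensionality_dep => a.
by apply: functional_extensionality_dep => aA; apply: alS.
Qed.

(** The target [X q] may vary with the current state [q]; one positional strategy then pursues at
    each state the target belonging to it. *)
Lemma forcing_strategy (X : St M -> St M -> Prop) :
  exists S, forall q, can_force true A q (X q) ->
    forall q', step_result (strategy_action S q) q' -> X q q'.
Proof.
have H q : exists alpha : action A q, can_force true A q (X q) ->
    forall q', step_result (alpha : step_choice true A q) q' -> X q q'.
  case: (classic (can_force true A q (X q))) => [[alpha alphaX]|nF].
    by exists alpha.
  by have [alpha] := action_exists A q; exists alpha.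
exists (fun a aA q => sval (constructive_indefinite_description _ (H q)) a aA).
by move=> q; apply: (svalP (constructive_indefinite_description _ (H q))).
Qed.

Lemma sat_f_next q psi :
  sat_f q (Next A psi) <-> can_force true A q (fun q' => sat_f q' psi).
Proof.
split=> [[S SX]|F].
  exists (strategy_action S q) => q' Rq'.
  have [L Lp] := paths_exists q' S.
  by have := SX _ (paths_cons Rq' Lp); case: Lp => /= ->.
have [S SX] := forcing_strategy (fun _ q' => sat_f q' psi).
by exists S => L /paths_behead [R1 _]; apply: SX R1.
Qed.

End Paths.

(** * Until and release as bounded winning conditions *)

Lemma least_index (T : Type) (W : nat -> T -> Prop) :
  exists r : T -> nat, forall x m, W m x -> W (r x) x /\ r x <= m.
Proof.
apply: (choice (fun x k => forall m, W m x -> W k x /\ k <= m)) => x.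
case: (classic (exists m, W m x)) => [[m]|nW]; last first.
  (* No index works for [x]; 0 is a default about which nothing is claimed. *)
  by exists 0 => m Wm; case: nW; exists m.
elim/ltn_ind: m => m IH Wm.
case: (classic (exists2 k, k < m & W k x)) => [[k /IH]|nk]; first exact.
exists m => k Wk; split=> //; rewrite leqNgt; apply/negP => km.
by apply: nk; exists k.
Qed.

(** Reversing the order by [k = n - m] reduces this to the least index. *)
Lemma greatest_index (T : Type) (W : nat -> T -> Prop) (n : nat) :
  exists r : T -> nat, forall x m, m <= n -> W m x -> W (r x) x /\ m <= r x <= n.
Proof.
apply: (choice (fun x k => forall m, m <= n -> W m x -> W k x /\ m <= k <= n)).
move=> x; have [r rP] := least_index (fun k (_ : unit) => k <= n /\ W (n - k) x).
exists (n - r tt) => m mn Wm.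
have [|[_ Wr] rm] := rP tt (n - m); first by rewrite subKn // leq_subr.
split=> //; rewrite leq_subr andbT.
by rewrite -(subKn mn) leq_sub2l.
Qed.

Section UntilRelease.

Variables (M : cgm) (A : coalition M) (psi theta : formula M).

Let Theta (q : St M) := sat_f q theta.
Let Psi (q : St M) := sat_f q psi.

Lemma sat_f_until q :
  sat_f q (Until A psi theta) <->
  exists n, bounded_win true true A Theta Psi n q.
Proof.
split=> [[n [S]]|[n Wn]].
  move=> SX; exists n; elim: n q SX => [|n IH] q SX.
    have [L Lp] := paths_exists q S; have [i []] := SX L Lp.
    by rewrite leqn0 => /eqP ->; case: Lp => ->.
  (* If [theta] fails at [q], the index [i] on every path is positive, whence [psi] at [q] and a
     bound reduced by one for the tails. *)
  case: (classic (Theta q)) => [|nT]; first by left.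
  right; split.
    have [L Lp] := paths_exists q S; have [[|i] [_]] := SX L Lp.
      by case: Lp => ->.
    by move=> _ /(_ 0 isT); case: Lp => ->.
  exists (strategy_action S q) => q' Rq'; apply: IH => L Lp.
  have [[|i] [in1 Ti Pj]] := SX _ (paths_cons Rq' Lp); first by [].
  by exists i; split=> // j ji; apply: (Pj j.+1).
have [r rP] := least_index (bounded_win true true A Theta Psi).
(* Playing at [q] for the least winning bound [r q], the next state wins with [(r q).-1], which is
   below every bound that wins at [q]; strong induction on the bound applies. *)
have [S SX] := forcing_strategy A
  (fun q => bounded_win true true A Theta Psi (r q).-1).
exists n, S => L; elim/ltn_ind: n q L Wn => n IH q L Wn Lp.
have [Wr rn] := rP q n Wn; have := SX q; move: Wr rn.
have L0 : L 0 = q by case: Lp.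
case: (r q) => [|k] /= Wr kn SXq; first by exists 0; rewrite L0.
case: Wr => [Tq|[Pq F]]; first by exists 0; rewrite L0.
have [R1 Lp1] := paths_behead Lp.
have [i [ik Ti Pj]] := IH k kn (L 1) _ (SXq F _ R1) Lp1.
exists i.+1; split=> //; first exact: leq_ltn_trans kn.
by move=> [|j] ji; [rewrite L0 | apply: Pj].
Qed.

Lemma sat_f_release q :
  sat_f q (Release A psi theta) <->
  forall n, bounded_win false true A Theta Psi n q.
Proof.
split=> [SX n|W n].
  have {SX} [S] := SX n; elim: n q => [|n IH] q SX.
    have [L Lp] := paths_exists q S.
    by case: (SX L Lp 0 isT) => [|[]] //; case: Lp => ->.
  split.
    have [L Lp] := paths_exists q S.
    by case: (SX L Lp 0 isT) => [|[]] //; case: Lp => ->.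
  case: (classic (Psi q)) => [|nP]; first by left.
  right; exists (strategy_action S q) => q' Rq'; apply: IH => L Lp i in1.
  case: (SX _ (paths_cons Rq' Lp) i.+1 in1) => [|[[|j] ji Pj]] //; first by left.
  by right; exists j.
have [r rP] := greatest_index (bounded_win false true A Theta Psi) n.
(* Here the bound must not drop too fast: a least index could be 0 and guarantee nothing later. With
   the greatest index up to [n], a state that wins with [m] steps left has [m <= r q], so its
   successor still wins with at least [m.-1]. *)
have [S SX] := forcing_strategy A
  (fun q => bounded_win false true A Theta Psi (r q).-1).
have claim i m q' L : paths q' S L -> m <= n ->
    bounded_win false true A Theta Psi m q' -> i <= m ->
    Theta (L i) \/ exists2 j, j < i & Psi (L j).
  elim: i q' m L => [|i IH] q' m L Lp mn Wm im.
    by left; case: Lp => -> _; case: m Wm {mn im} => [|m] //= [].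
  have [Wr /andP[mr rn]] := rP q' m mn Wm; have := SX q'; move: Wr mr rn.
  have L0 : L 0 = q' by case: Lp.
  (* The index cannot be 0, since [i.+1 <= m <= r q']. *)
  case: (r q') => [|k] /= Wr mk kn SXq; first by have := leq_trans im mk.
  case: Wr => [Tq [Pq|F]]; first by right; exists 0; rewrite ?L0.
  have [R1 Lp1] := paths_behead Lp.
  have [||[j ji Pj]] := IH (L 1) k _ Lp1 (ltnW kn) (SXq F _ R1).
  - exact: leq_trans im mk.
  - by left.
  - by right; exists j.+1.
by exists S => L Lp i; apply: (claim i n q).
Qed.

End UntilRelease.

(** * Truth at the locations of the evaluation game *)

Section EvaluationGame.

Variable M : cgm.
Implicit Types (P V : player) (q : St M) (g : egame M) (phi : formula M).

(** Truth is read relative to [P], so that verifier and falsifier roles are handled by the same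
    lemmas and negation merely swaps [V]. *)
Definition holds_for P V phi q : Prop :=
  if same P V then sat_f q phi else ~ sat_f q phi.

Definition conf_holds P g (m : nat) q : Prop :=
  bounded_win (same P (eC g)) (same P (eV g)) (eA g)
    (holds_for P (eV g) (eformC g)) (holds_for P (eV g) (eformN g)) m q.

Definition loc_holds P (x : location M) : Prop :=
  match x with
  | Pos V q phi => holds_for P V phi q
  | Conf g n m q => conf_holds P g m q
  end.

Lemma sameP P V : reflect (V = P) (same P V).
Proof. by case: P V => [] []; constructor. Qed.

Lemma same_opp P V : same P (opp V) = ~~ same P V.
Proof. by case: P V => [] []. Qed.

Lemma holds_for_neg P V phi q :
  holds_for P V (Neg phi) q <-> holds_for P (opp V) phi q.
Proof.
rewrite /holds_for same_opp; case: (same P V) => //=.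
by split=> [/NNPP|h] // nh; apply: nh.
Qed.

Lemma holds_for_next P V A phi q :
  holds_for P V (Next A phi) q <->
  can_force (same P V) A q (holds_for P V phi).
Proof.
rewrite /holds_for; case: (same P V) => /=; first exact: sat_f_next.
rewrite -[false]/(~~ true) can_force_dual; apply: not_iff_compat.
rewrite -/(sat_f q (Next A phi)) sat_f_next.
by split; apply: can_force_mono => q' //; [move=> h nh | move/NNPP].
Qed.

Lemma holds_for_until P V A psi theta q (g := EGame V V A q theta psi) :
  holds_for P V (Until A psi theta) q <->
  if same P (eC g) then exists n, conf_holds P g n q
  else forall n, conf_holds P g n q.
Proof.
rewrite /holds_for /conf_holds /= /holds_for; case: (same P V).
  exact: (sat_f_until A psi theta q).
rewrite -/(sat_f q (Until A psi theta)) sat_f_until.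
have D n := bounded_win_dual true true A (fun q => sat_f q theta)
  (fun q => sat_f q psi) n q.
split=> [nW n|W [n Wn]]; first by apply/D => Wn; apply: nW; exists n.
exact: (proj1 (D n) (W n)).
Qed.

Lemma holds_for_release P V A psi theta q (g := EGame V (opp V) A q theta psi) :
  holds_for P V (Release A psi theta) q <->
  if same P (eC g) then exists n, conf_holds P g n q
  else forall n, conf_holds P g n q.
Proof.
rewrite /holds_for /conf_holds /= same_opp /holds_for; case: (same P V) => /=.
  exact: (sat_f_release A psi theta q).
rewrite -/(sat_f q (Release A psi theta)) sat_f_release.
have D n := bounded_win_dual false true A (fun q => sat_f q theta)
  (fun q => sat_f q psi) n q.
split=> [nW|[n Wn] W]; last exact: (proj1 (D n) Wn).
by apply: NNPP => nE; apply: nW => n; apply: NNPP => nWn; apply: nE; exists n; apply/D.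
Qed.

Definition move_ok P g (m : nat) q
    (s : option (step_choice (same P (eV g)) (eA g) q)) : Prop :=
  match s with
  | None => holds_for P (eV g) (if same P (eC g) then eformC g else eformN g) q
  | Some c =>
      (same P (eC g) -> holds_for P (eV g) (eformN g) q) /\
      forall q', step_result c q' -> conf_holds P g m q'
  end.

(** The disjunct of [bounded_win] that holds dictates the move. [move_ok] omits the controller's
    exit when the opponent controls and [P] continues, because truth of the configuration already
    covers it. *)
Lemma truthful_estrategy P g :
  exists f : estrategy (same P (eV g)) (eA g), forall m q,
    conf_holds P g m.+1 q -> move_ok m (f m.+1 q).
Proof.
have H m q : exists s : option (step_choice (same P (eV g)) (eA g) q),
    conf_holds P g m.+1 q -> move_ok m s.
  case: (classic (conf_holds P g m.+1 q)) => [|n]; last by exists None.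
  rewrite /conf_holds /=; case E: (same P (eC g)).
    case=> [TC|[TN [c cW]]]; first by exists None; rewrite /= E.
    by exists (Some c) => _; split=> // q' /cW; rewrite /conf_holds E.
  case=> _ [TN|[c cW]]; first by exists None; rewrite /= E.
  exists (Some c) => _; split=> [|q' /cW]; first by rewrite E.
  by rewrite /conf_holds E.
exists (fun m q => sval (constructive_indefinite_description _ (H m.-1 q))) => m q.
exact: (svalP (constructive_indefinite_description _ (H m q))).
Qed.

Lemma truthful_econtrol P g :
  exists e : econtrol (same P (eC g)) (same P (eV g)) (eA g),
    (forall n m q, conf_holds P g m.+1 q ->
       move_ok m (estrategy_for e n m.+1 q)) /\
    ((if same P (eC g) then exists n, conf_holds P g n (eq0 g)
      else forall n, conf_holds P g n (eq0 g)) ->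
     forall n, elimit_ok e n -> conf_holds P g n (eq0 g)).
Proof.
have [f fP] := truthful_estrategy P g.
move: (conf_holds P g) (@move_ok P g) fP => W ok fP.
case: (same P (eC g)); last by exists (fun=> f).
case: (classic (exists n, W n (eq0 g))) => [[n Wn]|nW].
  by exists (n, f); split=> // _ n' ->.
(* No time limit wins, so the premise on limits fails and 0 is arbitrary. *)
by exists (0, f).
Qed.

Definition truthful P (Sg : strategy M P) : Prop :=
  forall x y, cmove Sg x y -> loc_holds P x -> loc_holds P y.

Lemma truthful_strategy P : exists Sg : strategy M P, truthful Sg.
Proof.
have Hn V q A psi : exists c : step_choice (same P V) A q,
    holds_for P V (Next A psi) q ->
    forall q', step_result c q' -> holds_for P V psi q'.
  case: (classic (holds_for P V (Next A psi) q)) => [|nh].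
    by move/holds_for_next => [c cX]; exists c.
  (* The position is already lost for [P], so any legal choice will do. *)
  have [alpha] := action_exists A q; have [beta] := action_exists (~: A) q.
  case: (same P V) nh => nh; first by exists alpha.
  by exists (fun _ => beta).
pose nx V q A psi := constructive_indefinite_description _ (Hn V q A psi).
pose eg g := constructive_indefinite_description _ (truthful_econtrol P g).
exists (Strategy
  (fun q psi theta =>
     if excluded_middle_informative (sat_f q psi) then true else false)
  (fun V q A psi => sval (nx V q A psi))
  (fun g => sval (eg g))).
move=> x y; case=> {x y} /=.
- by move=> V q psi; apply: (proj1 (holds_for_neg P V psi q)).
- move=> V q psi theta b; rewrite /holds_for; case: sameP => [VP|_] /=.
    by move=> /(_ VP) ->; case: excluded_middle_informative => //= nP [].
  by case: b => _ h h'; apply: h; [left | right].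
- by move=> V q A psi q' R h; apply: (svalP (nx V q A psi)) R.
- move=> V q A psi theta n ok /holds_for_until h.
  exact: (proj2 (svalP (eg (EGame V V A q theta psi))) h n ok).
- move=> V q A psi theta n ok /holds_for_release h.
  exact: (proj2 (svalP (eg (EGame V (opp V) A q theta psi))) h n ok).
- by [].
- move=> g n m q H h; have := proj1 (svalP (eg g)) n m q h; move: H.
  rewrite /emb_move /=; move: (estrategy_for _ n m.+1 q) => s.
  rewrite /move_ok; case: (sameP P (eC g)) => [CP /(_ CP) -> // | CP _ _].
  (* The opponent controls and exits: the conjunct [XC] of [bounded_win] makes the exit good for
     [P]. *)
  by move: h; rewrite /conf_holds /=; case: (sameP P (eC g)) => // _ [].
- move=> g n m q H1 H2 h; have := proj1 (svalP (eg g)) n m q h; move: H1 H2.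
  rewrite /emb_move /=; move: (estrategy_for _ n m.+1 q) => s.
  rewrite /move_ok; case: (sameP P (eC g)) => CP; last by move=> _ /(_ CP) ->.
  by move=> /(_ CP) + _; case: s => // c _ [+ _]; apply.
- move=> g n m q c q' Ec R h; have := proj1 (svalP (eg g)) n m q h.
  move: Ec; rewrite /emb_move /= => -> [_]; exact.
Qed.

Lemma truthful_winning P (Sg : strategy M P) x :
  truthful Sg -> loc_holds P x -> winning Sg x.
Proof.
move=> tS h s V q p; elim: s x h => [|y s IH] x h /=.
  move=> _ Ex; move: h; rewrite Ex /= /holds_for /wins_at.
  by case: P V {tS Sg Ex} => [] []; [left | right | right | left].
by move=> [/tS /(_ h) hy]; apply: IH.
Qed.

(** * From winning strategies back to truth *)

Lemma winning_cmove P (Sg : strategy M P) x y :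
  winning Sg x -> cmove Sg x y -> winning Sg y.
Proof. by move=> w xy s V q p c l; apply: (w (y :: s)). Qed.

(** The moves prescribed by [Sg] witness the existential parts of [bounded_win], and the free moves
    of the opponent yield the universal parts. *)
Lemma winning_conf P (Sg : strategy M P) g n m q :
  (forall q, winning Sg (Pos (eV g) q (eformC g)) ->
     holds_for P (eV g) (eformC g) q) ->
  (forall q, winning Sg (Pos (eV g) q (eformN g)) ->
     holds_for P (eV g) (eformN g) q) ->
  winning Sg (Conf g n m q) -> conf_holds P g m q.
Proof.
move=> hC hN; elim: m q => [|m IH] q w.
  by apply: hC; apply: winning_cmove w _; apply: cm_timeout.
have step c : emb_move Sg g n m.+1 q = Some c ->
    can_force (same P (eV g)) (eA g) q (conf_holds P g m).
  by move=> Ec; exists c => q' R; apply: IH; apply: winning_cmove w (cm_step Ec R).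
rewrite /conf_holds /=; case: (sameP P (eC g)) => CP.
  case Em: (emb_move Sg g n m.+1 q) => [c|].
    (* [P] controls and plays on, but the opponent may still exit; since [Sg] survives this, the
       exit [XN] is good. *)
    right; split.
      by apply: hN; apply: winning_cmove w _; apply: cm_endN; rewrite Em.
    by have := step c Em; rewrite /conf_holds; case: (sameP P (eC g)).
  by left; apply: hC; apply: winning_cmove w _; apply: cm_endC.
split; first by apply: hC; apply: winning_cmove w _; apply: cm_endC.
case Em: (emb_move Sg g n m.+1 q) => [c|].
  by right; have := step c Em; rewrite /conf_holds; case: (sameP P (eC g)).
by left; apply: hN; apply: winning_cmove w _; apply: cm_endN.
Qed.

Lemma elimit_ok_start P g (e : econtrol (same P (eC g)) (same P (eV g)) (eA g)) :
  (forall n, elimit_ok e n -> conf_holds P g n (eq0 g)) ->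
  if same P (eC g) then exists n, conf_holds P g n (eq0 g)
  else forall n, conf_holds P g n (eq0 g).
Proof.
move: (conf_holds P g) e => W; case: (same P (eC g)) => e h.
  by exists e.1; apply: h.
by move=> n; apply: h.
Qed.

Lemma winning_holds P (Sg : strategy M P) V q phi :
  winning Sg (Pos V q phi) -> holds_for P V phi q.
Proof.
elim: phi V q => [p|psi IH|psi IHp theta IHt|A psi IH|A psi IHp theta IHt
                 |A psi IHp theta IHt] V q w.
- have := w [::] V q p I erefl; rewrite /holds_for /wins_at.
  by case: P V {Sg w} => [] [] /= [] [].
- apply/holds_for_neg/IH; apply: winning_cmove w _; exact: cm_neg.
- have h b : (V = P -> b = on_or Sg q psi theta) ->
      holds_for P V (if b then psi else theta) q.
    by move=> /cm_or/(winning_cmove w); case: b => [/IHp|/IHt].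
  move: h; rewrite /holds_for; case: sameP => [VP|VP] h /=.
    (* As verifier, [P] owns the disjunct chosen by [Sg]; otherwise the opponent may choose either
       one, so both fail. *)
    by have := h _ (fun=> erefl); case: on_or; [left | right].
  by case; [apply: (h true) | apply: (h false)].
- apply/holds_for_next; exists (on_next Sg V q A psi) => q' R.
  by apply: IH; apply: winning_cmove w _; apply: cm_next.
- apply/holds_for_until; apply: (elimit_ok_start (e := on_egame Sg _)) => n ok.
  by apply: (@winning_conf P Sg _ n) => /=; auto; apply: winning_cmove w _; apply: cm_until.
- apply/holds_for_release; apply: (elimit_ok_start (e := on_egame Sg _)) => n ok.
  by apply: (@winning_conf P Sg _ n) => /=; auto; apply: winning_cmove w _; apply: cm_release.
Qed.

End EvaluationGame.

Theorem theorem5p6 (M : cgm) (q_in : St M) (phi : formula M) :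
  sat_f q_in phi <-> gsat_f q_in phi.
Proof.
split=> [h|[Sg w]]; last exact: (winning_holds w).
have [Sg tS] := truthful_strategy M Eloise.
by exists Sg; apply: truthful_winning.
Qed.
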